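(* Let $\mathbf{M}=M_{\star,\star}(\mathbb{Z}_+)$ be the prop of matrices with coefficients in $\mathbb{Z}_+$, and let $\iota:\mathbf{M}\to\widehat{\mathbf{M}}$ be a traced completion of $\mathbf{M}$. To any square matrix $M$ over $\mathbb{Z}_+$, of size $n\times n$, associate the morphism $\tilde M = tr_n(\iota(M)) : 0\to 0$ of $\widehat{\mathbf{M}}$. Let $M$ and $N$ be two square matrices over $\mathbb{Z}_+$, possibly of different sizes. Then $\tilde M=\tilde N$ if and only if $M$ and $N$ are flow-equivalent.
   Context: $\mathbb{Z}_+$ is the semiring of nonnegative integers. Props. A prop is a strict symmetric monoidal category whose objects are the natural numbers, with tensor product on objects given by addition; $P[n,m]$ is the set of morphisms $n\to m$, $id:1\to1$ is the identity and $\sigma:2\to2$ the symmetry. A prop functor is an identity-on-objects strict symmetric monoidal functor. The prop $M_{\star,\star}(\mathbb{Z}_+)$: morphisms $n\to m$ are the $m\times n$ matrices over $\mathbb{Z}_+$ (sizes may be $0$), $\circ$ is the matrix product, $A\otimes B=\begin{pmatrix} A & 0 \\ 0 & B \end{pmatrix}$, and the symmetry $\sigma$ is $\begin{pmatrix} 0 & 1 \\ 1 & 0 \end{pmatrix}$. Traced props. A traced prop is a prop with operators $tr$ sending each morphism $1+m\to 1+n$ to a morphism $m\to n$ (thought of as plugging the first output into the first input), such that, writing $tr_p$ for the $p$-th iterate of $tr$ ($tr_0(f)=f$): - (Tightening) $tr((id\otimes g)\circ f\circ(id\otimes h))=g\circ tr(f)\circ h$; - (Yanking) $tr(\sigma)=id$;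 - (Sliding) $tr_n(f\circ(g\otimes id^{\otimes p}))=tr_m((g\otimes id^{\otimes q})\circ f)$ for $f:m+p\to n+q$ and $g:n\to m$; - (Strength) $tr(f\otimes g)=tr(f)\otimes g$. A traced prop functor is a prop functor $F$ with $tr\,F(f)=F(tr\,f)$. Traced completion. A traced completion of a prop $P$ is a traced prop $\widehat P$ with a prop functor $\iota:P\to\widehat P$ such that for every traced prop $Q$ and prop functor $\eta:P\to Q$ there is a unique traced prop functor $G:\widehat P\to Q$ with $G\iota=\eta$. Flow equivalence. Flow equivalence is the smallest equivalence relation $\simeq$ on square matrices over $\mathbb{Z}_+$ (of all sizes) such that - $RS\simeq SR$ for all (not necessarily square) matrices $R,S$ over $\mathbb{Z}_+$ such that both products are defined; - $\begin{pmatrix} a \\ A \end{pmatrix}\simeq\begin{pmatrix} 0 & 1 \\ A & 0 \\ a & 0 \end{pmatrix}$ for every square matrix with first row $a$ and remaining rows $A$ (if the left matrix is $n\times n$, the right one is $(n+1)\times(n+1)$, its last column having a single nonzero entry, equal to $1$, in the first row). *)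

(* Defs.v *)
From HB Require Import structures.
From mathcomp Require Import all_boot all_order all_algebra.

Set Implicit Arguments.
Unset Strict Implicit.
Unset Printing Implicit Defensive.

(* Transport along equalities of objects: [(n + m) + p] and [n + (m + p)] are
   equal but not convertible, so strictness can only be expressed with casts. *)
Definition hcast (H : nat -> nat -> Type) n m n' m'
    (en : n = n') (em : m = m') (f : H n m) : H n' m' :=
  ecast k (H k m') en (ecast k (H n k) em f).

(* [pcomp g f] is "g after f"; [sw n m] is the symmetry n + m -> m + n. *)
Record prop_cat := PropCat {
  phom : nat -> nat -> Type;
  pidm : forall n, phom n n;
  pcomp : forall {n m p}, phom m p -> phom n m -> phom n p;
  tens : forall {n m n' m'}, phom n m -> phom n' m' -> phom (n + n') (m + m');
  sw : forall n m, phom (n + m) (m + n);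
  comp1m : forall n m (f : phom n m), pcomp (pidm m) f = f;
  compm1 : forall n m (f : phom n m), pcomp f (pidm n) = f;
  compA : forall n m p q (h : phom p q) (g : phom m p) (f : phom n m),
    pcomp h (pcomp g f) = pcomp (pcomp h g) f;
  tens11 : forall n m, tens (pidm n) (pidm m) = pidm (n + m);
  tens_comp : forall n m p n' m' p' (g : phom m p) (f : phom n m)
      (g' : phom m' p') (f' : phom n' m'),
    tens (pcomp g f) (pcomp g' f') = pcomp (tens g g') (tens f f');
  tensA : forall n m n' m' n'' m''
      (f : phom n m) (g : phom n' m') (h : phom n'' m''),
    hcast (addnA n n' n'') (addnA m m' m'') (tens f (tens g h)) =
    tens (tens f g) h;
  tens1m : forall n m (f : phom n m), tens (pidm 0) f = f;
  tensm1 : forall n m (f : phom n m),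
    hcast (addn0 n) (addn0 m) (tens f (pidm 0)) = f;
  sw_nat : forall n m n' m' (f : phom n m) (g : phom n' m'),
    pcomp (sw m m') (tens f g) = pcomp (tens g f) (sw n n');
  swK : forall n m, pcomp (sw m n) (sw n m) = pidm (n + m);
  sw0 : forall n, hcast (addn0 n) erefl (sw n 0) = pidm n;
  swD : forall n m p,
    sw n (m + p) =
    hcast (esym (addnA n m p)) (addnA m p n)
      (pcomp (tens (pidm m) (sw n p))
             (hcast erefl (esym (addnA m n p)) (tens (sw n m) (pidm p))))
}.

Arguments pcomp {_ n m p} g f.
Arguments tens {_ n m n' m'} f g.
Arguments pidm {_} n.
Arguments sw {_} n m.

Record prop_functor (P Q : prop_cat) := PropFunctor {
  fmap : forall {n m}, phom P n m -> phom Q n m;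
  fmap1 : forall n, fmap (pidm n) = pidm n;
  fmap_comp : forall n m p (g : phom P m p) (f : phom P n m),
    fmap (pcomp g f) = pcomp (fmap g) (fmap f);
  fmap_tens : forall n m n' m' (f : phom P n m) (g : phom P n' m'),
    fmap (tens f g) = tens (fmap f) (fmap g);
  fmap_sw : forall n m, fmap (sw n m) = sw n m
}.

Arguments fmap {P Q} _ {n m} f.

Fixpoint iter_tr (H : nat -> nat -> Type)
    (tr : forall m n, H (1 + m) (1 + n) -> H m n) p m n :
    H (p + m) (p + n) -> H m n :=
  if p is p'.+1 then fun f => iter_tr tr (tr (p' + m) (p' + n) f)
  else fun f => f.

(* Strength is well typed without a cast because [(1 + m) + m'] is convertible
   to [1 + (m + m')]. *)
Record traced_prop := TracedProp {
  traced_base :> prop_cat;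
  tr : forall {m n}, phom traced_base (1 + m) (1 + n) -> phom traced_base m n;
  tr_tightening : forall m n m' n' (f : phom traced_base (1 + m) (1 + n))
      (g : phom traced_base n n') (h : phom traced_base m' m),
    tr (pcomp (pcomp (tens (pidm 1) g) f) (tens (pidm 1) h)) =
    pcomp (pcomp g (tr f)) h;
  tr_yanking : tr (sw 1 1) = pidm 1;
  tr_sliding : forall m n p q (f : phom traced_base (m + p) (n + q))
      (g : phom traced_base n m),
    iter_tr (@tr) (p := n) (pcomp f (tens g (pidm p))) =
    iter_tr (@tr) (p := m) (pcomp (tens g (pidm q)) f);
  tr_strength : forall m n m' n' (f : phom traced_base (1 + m) (1 + n))
      (g : phom traced_base m' n'),
    tr (m := m + m') (n := n + n') (tens f g) = tens (tr f) g
}.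

Arguments tr {_ m n} f.

Definition trn (Q : traced_prop) p m n (f : phom Q (p + m) (p + n)) :
    phom Q m n :=
  iter_tr (@tr Q) f.

Definition closed_trace (Q : traced_prop) n (f : phom Q n n) : phom Q 0 0 :=
  trn (hcast (esym (addn0 n)) (esym (addn0 n)) f).

Definition is_traced_functor (P Q : traced_prop) (F : prop_functor P Q) :=
  forall m n (f : phom P (1 + m) (1 + n)), tr (fmap F f) = fmap F (tr f).

Definition is_traced_completion (P : prop_cat) (Phat : traced_prop)
    (iota : prop_functor P Phat) : Prop :=
  forall (Q : traced_prop) (eta : prop_functor P Q),
    exists G : prop_functor Phat Q,
      [/\ is_traced_functor G,
          forall n m (f : phom P n m), fmap G (fmap iota f) = fmap eta f &
          forall G' : prop_functor Phat Q,
            is_traced_functor G' ->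
            (forall n m (f : phom P n m), fmap G' (fmap iota f) = fmap eta f) ->
            forall n m (f : phom Phat n m), fmap G' f = fmap G f].

Section MatrixProp.
Import GRing.Theory.
Local Open Scope ring_scope.
Variable R : pzSemiRingType.

Definition mat_hom (n m : nat) : Type := 'M[R]_(m, n).

Definition mat_comp n m p (g : mat_hom m p) (f : mat_hom n m) : mat_hom n p :=
  g *m f.

Definition mat_tens n m n' m' (f : mat_hom n m) (g : mat_hom n' m') :
    mat_hom (n + n') (m + m') :=
  block_mx f 0 0 g.

Definition mat_sw n m : mat_hom (n + m) (m + n) :=
  block_mx 0 1%:M 1%:M 0.

Lemma hcast_mat n m n' m' (en : n = n') (em : m = m') (f : mat_hom n m) :
  hcast en em f = castmx (em, en) f.
Proof. by case: n' / en; case: m' / em. Qed.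

Lemma mat_compA n m p q
    (h : mat_hom p q) (g : mat_hom m p) (f : mat_hom n m) :
  mat_comp h (mat_comp g f) = mat_comp (mat_comp h g) f.
Proof. exact: mulmxA. Qed.

Lemma mat_tens11 n m :
  mat_tens (1%:M : mat_hom n n) (1%:M : mat_hom m m) = 1%:M.
Proof. by rewrite [RHS]scalar_mx_block. Qed.

Lemma mat_tens_comp n m p n' m' p' (g : mat_hom m p) (f : mat_hom n m)
    (g' : mat_hom m' p') (f' : mat_hom n' m') :
  mat_tens (mat_comp g f) (mat_comp g' f') =
  mat_comp (mat_tens g g') (mat_tens f f').
Proof.
by rewrite /mat_comp /mat_tens mulmx_block !mulmx0 !mul0mx !addr0 !add0r.
Qed.

Lemma mat_tensA n m n' m' n'' m''
    (f : mat_hom n m) (g : mat_hom n' m') (h : mat_hom n'' m'') :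
  hcast (addnA n n' n'') (addnA m m' m'') (mat_tens f (mat_tens g h)) =
  mat_tens (mat_tens f g) h.
Proof.
rewrite hcast_mat /mat_tens -[X in block_mx f X _ _]row_mx0.
rewrite -[X in block_mx f _ X _]col_mx0 block_mxA castmx_comp.
by rewrite castmx_id col_mx0 row_mx0.
Qed.

Lemma mat_tens1m n m (f : mat_hom n m) : mat_tens (1%:M : mat_hom 0 0) f = f.
Proof.
apply/matrixP => i j.
have -> : i = rshift 0 i by apply: val_inj.
have -> : j = rshift 0 j by apply: val_inj.
by rewrite block_mxEdr; congr (f _ _); apply: val_inj.
Qed.

Lemma mat_tensm1 n m (f : mat_hom n m) :
  hcast (addn0 n) (addn0 m) (mat_tens f (1%:M : mat_hom 0 0)) = f.
Proof.
rewrite hcast_mat; apply/matrixP => i j; rewrite castmxE.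
set i' := cast_ord _ i; set j' := cast_ord _ j.
have -> : i' = lshift 0 i by apply: val_inj.
have -> : j' = lshift 0 j by apply: val_inj.
by rewrite block_mxEul.
Qed.

Lemma mat_sw_nat n m n' m' (f : mat_hom n m) (g : mat_hom n' m') :
  mat_comp (mat_sw m m') (mat_tens f g) = mat_comp (mat_tens g f) (mat_sw n n').
Proof.
rewrite /mat_comp /mat_tens /mat_sw !mulmx_block.
by rewrite !mulmx0 !mul0mx !mulmx1 !mul1mx !addr0 !add0r.
Qed.

Lemma mat_swK n m : mat_comp (mat_sw m n) (mat_sw n m) = 1%:M.
Proof.
rewrite /mat_comp /mat_sw mulmx_block.
by rewrite !mulmx0 !mul0mx !mulmx1 !addr0 !add0r -scalar_mx_block.
Qed.

Lemma mat_sw0 n : hcast (addn0 n) erefl (mat_sw n 0) = 1%:M.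
Proof.
rewrite hcast_mat; apply/matrixP => i j; rewrite castmxE cast_ord_id.
set j' := cast_ord _ j.
have -> : j' = lshift 0 j by apply: val_inj.
have {1}-> : i = rshift 0 i by apply: val_inj.
by rewrite block_mxEdl.
Qed.

Lemma mat_swD n m p :
  mat_sw n (m + p) =
  hcast (esym (addnA n m p)) (addnA m p n)
    (mat_comp (mat_tens (1%:M : mat_hom m m) (mat_sw n p))
       (hcast erefl (esym (addnA m n p))
          (mat_tens (mat_sw n m) (1%:M : mat_hom p p)))).
Proof.
set A := mat_tens _ _; set B := mat_tens _ _.
have -> : hcast (esym (addnA n m p)) (addnA m p n)
    (mat_comp A (hcast erefl (esym (addnA m n p)) B)) =
  hcast erefl (addnA m p n) (mat_comp A
    (hcast (esym (addnA n m p)) (esym (addnA m n p)) B)).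
  by case: _ / (esym (addnA n m p)).
rewrite !hcast_mat /mat_comp {}/A {}/B /mat_tens /mat_sw.
rewrite -[X in block_mx (block_mx _ _ _ _) X]col_mx0.
rewrite -[X in block_mx (block_mx _ _ _ _) _ X]row_mx0 -block_mxA.
rewrite mulmx_block !mul0mx !mul1mx !addr0 !add0r.
rewrite mul_block_col mulmx_block !mul0mx !mul1mx !addr0 !add0r.
rewrite [X in block_mx _ X _ _]scalar_mx_block.
have row_col m1 m2 n1 n2 (Aul : 'M[R]_(m1, n1)) Aur (Adl : 'M_(m2, n1))
    (Adr : 'M_(m2, n2)) :
  row_mx (col_mx Aul Adl) (col_mx Aur Adr) =
  col_mx (row_mx Aul Aur) (row_mx Adl Adr) by rewrite -block_mxEh.
rewrite /block_mx row_col -[X in row_mx X (col_mx _ _)]col_mx0 row_col.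
by rewrite col_mxA castmx_comp castmx_id row_mx0.
Qed.

Definition mat_prop : prop_cat :=
  @PropCat mat_hom (fun n => 1%:M) mat_comp mat_tens mat_sw
    (fun n m f => mul1mx f) (fun n m f => mulmx1 f) mat_compA
    mat_tens11 mat_tens_comp mat_tensA mat_tens1m mat_tensm1
    mat_sw_nat mat_swK mat_sw0 mat_swD.

End MatrixProp.

Section FlowEquivalence.
Import GRing.Theory.
Local Open Scope ring_scope.

Inductive flow_equiv : forall n m, 'M[nat]_n -> 'M[nat]_m -> Prop :=
| flow_refl n (M : 'M[nat]_n) : flow_equiv M M
| flow_sym n m (M : 'M[nat]_n) (N : 'M[nat]_m) :
    flow_equiv M N -> flow_equiv N M
| flow_trans n m p (M : 'M[nat]_n) (N : 'M[nat]_m) (L : 'M[nat]_p) :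
    flow_equiv M N -> flow_equiv N L -> flow_equiv M L
| flow_shift n m (R : 'M[nat]_(n, m)) (S : 'M[nat]_(m, n)) :
    flow_equiv (R *m S) (S *m R)
| flow_expand n (a : 'rV[nat]_n.+1) (A : 'M[nat]_(n, n.+1)) :
    flow_equiv (col_mx a A : 'M[nat]_(1 + n))
      (block_mx 0 (1%:M : 'M[nat]_1)
                (col_mx A a) 0 : 'M[nat]_(1 + (n + 1))).

End FlowEquivalence.

(* Main.v *)
(* If M and N are flow equivalent then their closed traces agree: RS and SR by
   sliding, and the delayed matrix because, up to sliding a symmetry around the
   loop, its first wire is traced through the symmetry, which yanking removes.

   For the converse it suffices, by the universal property of the completion, to
   exhibit one traced prop under M whose closed traces of matrices separate flow
   classes. Its morphisms n -> m are finite graphs whose vertices carry n inputs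
   and m outputs (state space realisations with no direct feed-through from input
   to output), identified when plugging them into any graph m -> n yields flow
   equivalent closed graphs. Composition and trace then only add edges, and every
   law is a relabelling of vertices together with the elimination of a set J of
   vertices with no edge inside J: for flow equivalence, [A B; C 0] ~ A + BC.
   A closed morphism is a square matrix up to flow equivalence. *)
From Pilot Require Import Defs.
From HB Require Import structures.
From mathcomp Require Import all_boot all_order all_algebra.
From mathcomp Require Import boolp zify.
(* Gives [pcomp] back its meaning from Defs, shadowed by [ssrfun.pcomp]. *)
Import Pilot.Defs.

Import GRing.Theory.

Set Implicit Arguments.
Unset Strict Implicit.
Unset Printing Implicit Defensive.

(** * Flow equivalence of matrices indexed by finite types *)

Section FinFlow.
Implicit Types I J K : finType.

Definition mx_of I (A : I -> I -> nat) : 'M[nat]_#|I| :=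
  \matrix_(i, j) A (enum_val i) (enum_val j).

(** Vertices range over finite types rather than ordinals, so that joining graphs is a disjoint sum
    and relabelling is a bijection, with no casts on matrix sizes. *)
Definition fe I J (A : I -> I -> nat) (B : J -> J -> nat) : Prop :=
  flow_equiv (mx_of A) (mx_of B).

Lemma fe_sym I J (A : I -> I -> nat) (B : J -> J -> nat) : fe A B -> fe B A.
Proof. exact: flow_sym. Qed.

Lemma fe_trans I J K (A : I -> I -> nat) (B : J -> J -> nat)
  (C : K -> K -> nat) : fe A B -> fe B C -> fe A C.
Proof. exact: flow_trans. Qed.

Lemma sum_enum_val I (F : I -> nat) :
  \sum_(k < #|I|) F (enum_val k) = \sum_i F i.
Proof.
rewrite [RHS](reindex (@enum_val I I)) /=.
  by apply: eq_bigl => k; rewrite ?inE.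
by apply/onW_bij/enum_val_bij.
Qed.

Lemma fe_shift I J (A : I -> I -> nat) (B : J -> J -> nat)
    (R : I -> J -> nat) (S : J -> I -> nat) :
  (forall i i', A i i' = \sum_j R i j * S j i') ->
  (forall j j', B j j' = \sum_i S j i * R i j') -> fe A B.
Proof.
move=> eA eB.
pose R' := (\matrix_(i < #|I|, j < #|J|) R (enum_val i) (enum_val j))%R.
pose S' := (\matrix_(j < #|J|, i < #|I|) S (enum_val j) (enum_val i))%R.
have -> : fe A B = flow_equiv (R' *m S')%R (S' *m R')%R.
  congr flow_equiv; apply/matrixP => x y; rewrite !mxE.
    rewrite eA -sum_enum_val; apply: eq_bigr => k _; by rewrite !mxE.
  rewrite eB -sum_enum_val; apply: eq_bigr => k _; by rewrite !mxE.
exact: flow_shift.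
Qed.

Lemma sum_delta I (i0 : I) (F : I -> nat) : \sum_i (i == i0) * F i = F i0.
Proof.
rewrite (bigD1 i0) //= eqxx mul1n big1 ?addn0 // => i /negbTE ->.
by rewrite mul0n.
Qed.

(** Permutation similarity is an instance of [RS ~ SR]: [R] is the permutation matrix of [h] and [S]
    is [B] with its columns pulled back along [h]. *)
Lemma fe_iso I J (h : I -> J) (A : I -> I -> nat) (B : J -> J -> nat) :
  bijective h -> (forall i i', A i i' = B (h i) (h i')) -> fe A B.
Proof.
case=> g hK gK eAB.
apply: (@fe_shift _ _ _ _ (fun i j => (j == h i)) (fun j i => B j (h i))).
  by move=> i i'; rewrite eAB (sum_delta (h i) (fun j => B j (h i'))).
move=> j j'; under eq_bigr => i _.
  rewrite mulnC (_ : (j' == h i) = (i == g j')); first over.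
  by apply/eqP/eqP => [-> | ->]; rewrite ?hK ?gK.
by rewrite (sum_delta (g j') (fun i => B j (h i))) gK.
Qed.

(** The sizes [n] and [#|'I_n|] are equal but not convertible. Factoring [A] as [P Q], with [P] a
    rectangular reindexing matrix, avoids a cast. *)
Lemma fe_mx n (A : 'M[nat]_n) : flow_equiv A (mx_of (fun i j => A i j)).
Proof.
pose P : 'M[nat]_(n, #|'I_n|) := (\matrix_(i, j) (enum_val j == i)%:R)%R.
pose Q : 'M[nat]_(#|'I_n|, n) := (\matrix_(i, j) A (enum_val i) j)%R.
have PQ : (P *m Q = A)%R.
  apply/matrixP => i j; rewrite mxE.
  rewrite -[RHS](sum_delta i (fun i => A i j)) -sum_enum_val.
  apply: eq_bigr => k _; rewrite !mxE; by case: eqP.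
rewrite -{1}PQ (_ : mx_of _ = Q *m P)%R; first exact: flow_shift.
apply/matrixP => i j; rewrite !mxE.
rewrite -(sum_delta (enum_val j) (fun k => A (enum_val i) k)).
apply: eq_bigr => k _; rewrite !mxE /= mulnC eq_sym; by case: eqP.
Qed.

End FinFlow.

(** * Delay and elimination of vertices up to flow equivalence *)

Section Expand.
Implicit Types I J K : finType.

(** The expansion move, with [inr tt] of [I + unit] as the distinguished first row. The added vertex
    takes over the row of the distinguished one, which keeps a single entry 1, in the new column. *)
Definition delay I (M : I + unit -> I + unit -> nat)
    (v w : I + unit + unit) : nat :=
  match v, w with
  | inl (inl i), inl w => M (inl i) w
  | inr _, inl w => M (inr tt) w
  | inl (inr _), inr _ => 1
  | _, _ => 0
  end.

Lemma fe_delay I (M : I + unit -> I + unit -> nat) : fe M (delay M).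
Proof.
pose n := #|I|.
(* The distinguished vertex is numbered first, since [flow_expand] acts on the first row. *)
pose g (i : 'I_(1 + n)) : I + unit :=
  match split i with inl _ => inr tt | inr k => inl (enum_val k) end.
pose gV (x : I + unit) : 'I_(1 + n) :=
  match x with inl x => rshift 1 (enum_rank x) | inr _ => lshift n ord0 end.
have gr k : g (rshift 1 k) = inl (enum_val k).
  by rewrite /g (unsplitK (inr k : 'I_1 + 'I_n)).
have gl k : g (lshift n k) = inr tt.
  by rewrite /g (unsplitK (inl k : 'I_1 + 'I_n)).
have gK : cancel g gV.
  move=> i; rewrite -(splitK i); case: (split i) => k /=.
    by rewrite gl /= [k]ord1.
  by rewrite gr /= enum_valK.
have gVK : cancel gV g.
  by case=> [x|[]] /=; rewrite ?gl // gr enum_rankK.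
pose h (i : 'I_((1 + n) + 1)) : I + unit + unit :=
  match split i with inl k => inl (g k) | inr _ => inr tt end.
pose hV (x : I + unit + unit) : 'I_((1 + n) + 1) :=
  match x with inl x => lshift 1 (gV x) | inr _ => rshift (1 + n) ord0 end.
have hl k : h (lshift 1 k) = inl (g k).
  by rewrite /h (unsplitK (inl k : 'I_(1 + n) + 'I_1)).
have hr k : h (rshift (1 + n) k) = inr tt.
  by rewrite /h (unsplitK (inr k : 'I_(1 + n) + 'I_1)).
have hK : cancel h hV.
  move=> i; rewrite -(splitK i); case: (split i) => k /=.
    by rewrite hl /= gK.
  by rewrite hr /= [k]ord1.
have hVK : cancel hV h.
  by case=> [x|[]] /=; rewrite ?hr // hl gVK.
pose a := (\row_(j < 1 + n) M (inr tt) (g j))%R : 'rV[nat]_n.+1.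
pose A := (\matrix_(i < n, j < 1 + n) M (inl (enum_val i)) (g j))%R
  : 'M[nat]_(n, n.+1).
have := flow_expand a A.
set X := (X in flow_equiv X _); set Y := (Y in flow_equiv _ Y) => XY.
apply: (@fe_trans _ 'I_(1 + n) _ _ (fun i j => X i j)).
  apply: fe_sym; apply: (fe_iso (h := g)); first by exists gV.
  move=> i j; rewrite -[in LHS](splitK i) -[in RHS](splitK i).
  case: (split i) => k /=.
    by rewrite gl /X [LHS]col_mxEu mxE.
  by rewrite gr /X [LHS]col_mxEd mxE.
apply: (@fe_trans _ 'I_((1 + n) + 1) _ _ (fun i j => (Y : 'M_((1 + n) + 1)) i j)).
  exact: flow_trans (flow_sym (fe_mx X)) (flow_trans XY (fe_mx _)).
apply: (fe_iso (h := h)); first by exists hV.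
move=> i j.
(* Following the blocks of the expanded matrix, columns are cut as [(1 + n) + 1] and rows as
   [1 + (n + 1)]; the two index types are convertible. *)
rewrite -[in LHS](splitK j) -[in RHS](splitK j).
have -> : i = (unsplit (split (i : 'I_(1 + (n + 1)))) : 'I_(1 + (n + 1))).
  by rewrite splitK.
case: (split (i : 'I_(1 + (n + 1)))) => [k|k] /=.
  have -> : h (lshift (n + 1) k) = inl (inr tt).
    by rewrite -(gl k) -hl; congr h; apply: val_inj.
  case: (split j) => l /=; rewrite ?hl ?hr.
    by rewrite /Y [LHS]block_mxEul mxE.
  by rewrite /Y [LHS]block_mxEur mxE [k]ord1 [l]ord1.
rewrite -(splitK k); case: (split k) => {}k /=.
  have -> : h (rshift 1 (lshift 1 k)) = inl (inl (enum_val k)).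
    by rewrite -gr -hl; congr h; apply: val_inj.
  case: (split j) => l /=; rewrite ?hl ?hr.
    by rewrite /Y [LHS]block_mxEdl col_mxEu mxE.
  by rewrite /Y [LHS]block_mxEdr mxE.
have -> : h (rshift 1 (rshift n k)) = inr tt.
  by rewrite -(hr k); congr h; apply: val_inj.
case: (split j) => l /=; rewrite ?hl ?hr.
  by rewrite /Y [LHS]block_mxEdl col_mxEd mxE.
by rewrite /Y [LHS]block_mxEdr mxE.
Qed.

Lemma big_void (F : void -> nat) : \sum_i F i = 0.
Proof. by rewrite big1 // => -[]. Qed.

Lemma big_unit (F : unit -> nat) : \sum_i F i = F tt.
Proof. by rewrite (bigD1 tt) //= big1 ?addn0 // => -[]. Qed.

(* With M = [A B; C 0], factoring A + BC = [1 B][A; C] gives [A AB; C CB];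
   delaying its last vertex gives T U with T = [A 0; 0 1; C 0] and
   U = [1 B 0; 0 0 1], and U T = M. *)
Lemma fe_elim1 I (M : I + unit -> I + unit -> nat) :
  M (inr tt) (inr tt) = 0 ->
  fe (fun i j => M (inl i) (inl j) + M (inl i) (inr tt) * M (inr tt) (inl j)) M.
Proof.
move=> M0.
pose N (v w : I + unit) :=
  match v, w with
  | inl i, inl j => M (inl i) (inl j)
  | inl i, inr _ => \sum_k M (inl i) (inl k) * M (inl k) (inr tt)
  | inr _, inl j => M (inr tt) (inl j)
  | inr _, inr _ => \sum_k M (inr tt) (inl k) * M (inl k) (inr tt)
  end.
apply: (@fe_trans _ (I + unit)%type _ _ N).
  apply: (fe_shift
    (R := fun i v => match v with inl k => (i == k) : nat
                                | inr _ => M (inl i) (inr tt) end)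
    (S := fun v j => match v with inl k => M (inl k) (inl j)
                                | inr _ => M (inr tt) (inl j) end)).
    move=> i j; rewrite big_sumType big_unit /=; congr (_ + _).
    under eq_bigr => k _ do rewrite eq_sym.
    by rewrite (sum_delta i (fun k => M (inl k) (inl j))).
  case=> [i|[]] [j|[]] //=; under eq_bigr do rewrite mulnC.
    by rewrite (sum_delta j (fun k => M (inl i) (inl k))).
  by rewrite (sum_delta j (fun k => M (inr tt) (inl k))).
apply: (fe_trans (fe_delay N)).
apply: (fe_shift
  (R := fun v x => match v, x with
     | inl (inl i), inl k => M (inl i) (inl k)
     | inl (inr _), inr _ => 1
     | inr _, inl k => M (inr tt) (inl k)
     | _, _ => 0 end)
  (S := fun x v => match x, v with
     | inl i, inl (inl k) => (i == k) : nat
     | inl i, inl (inr _) => M (inl i) (inr tt)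
     | inr _, inr _ => 1
     | _, _ => 0 end)).
  case=> [[i|[]]|[]] [[j|[]]|[]];
    rewrite big_sumType big_unit /= ?muln0 ?addn0 ?mul0n //;
    first [ by rewrite big1 // => k _; rewrite ?muln0
          | under eq_bigr do rewrite mulnC;
            by rewrite (sum_delta j (fun k => M _ (inl k)))].
case=> [i|[]] [j|[]]; rewrite !big_sumType !big_unit /= ?muln0 ?addn0 ?muln1 ?M0 //.
- under eq_bigr => k _ do rewrite eq_sym.
  by rewrite (sum_delta i (fun k => M (inl k) (inl j))).
- by rewrite big1 // => k _; rewrite muln0.
- by rewrite big1 // mul1n.
- by rewrite big1.
Qed.

(** The vertices go one at a time. Since no edge joins two of them, removing one leaves the rows and
    columns of the others unchanged, so the hypothesis survives and the contributions add up. *)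
Lemma fe_elim_ord I p (M : I + 'I_p -> I + 'I_p -> nat) :
  (forall u u', M (inr u) (inr u') = 0) ->
  fe (fun i j => M (inl i) (inl j) + \sum_u M (inl i) (inr u) * M (inr u) (inl j))
     M.
Proof.
elim: p I M => [|p IH] I M M0.
  apply: fe_sym; apply: (fe_iso
    (h := fun x : I + 'I_0 => match x with
            inl i => i | inr u => match notF (ltn_ord u) with end end)).
    by exists inl => //; case=> // -[].
  by case=> [i|[]] // [j|[]] //; rewrite big_ord0 addn0.
pose h (x : I + 'I_p + unit) : I + 'I_p.+1 :=
  match x with inl (inl i) => inl i | inl (inr u) => inr (lift ord0 u)
             | inr _ => inr ord0 end.
pose M' x y := M (h x) (h y).
have := @fe_elim1 _ M' (M0 _ _) => elim1.
pose A (x y : I + 'I_p) :=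
  M' (inl x) (inl y) + M' (inl x) (inr tt) * M' (inr tt) (inl y).
have A0 u u' : A (inr u) (inr u') = 0 by rewrite /A /M' /= !M0.
have := IH _ A A0 => IHA.
have -> : (fun i j => M (inl i) (inl j) +
            \sum_u M (inl i) (inr u) * M (inr u) (inl j)) =
          (fun i j => A (inl i) (inl j) +
            \sum_u A (inl i) (inr u) * A (inr u) (inl j)).
  apply/funext => i; apply/funext => j; rewrite big_ord_recl {1}/A /M' /= addnA.
  congr (_ + _); apply: eq_bigr => u _.
  by rewrite /A /M' /= !M0 muln0 mul0n !addn0.
apply: (fe_trans IHA); apply: (fe_trans elim1).
apply: (fe_iso (h := h)) => //.
exists (fun x => match x with inl i => inl (inl i)
   | inr u => match unlift ord0 u with Some v => inl (inr v) | None => inr tt end end).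
  by case=> [[i|u]|[]] //=; rewrite ?liftK ?unlift_none.
by case=> [i|u] //=; case: unliftP => [v|] -> .
Qed.

Lemma fe_elim I J K (h : I + J -> K) (A : I -> I -> nat) (M : K -> K -> nat) :
  bijective h ->
  (forall u u', M (h (inr u)) (h (inr u')) = 0) ->
  (forall i j, A i j = M (h (inl i)) (h (inl j)) +
     \sum_u M (h (inl i)) (h (inr u)) * M (h (inr u)) (h (inl j))) ->
  fe A M.
Proof.
move=> bh M0 eA.
pose h' (x : I + 'I_#|J|) : I + J :=
  match x with inl i => inl i | inr u => inr (enum_val u) end.
have bh' : bijective h'.
  exists (fun x => match x with inl i => inl i | inr u => inr (enum_rank u) end).
    by case=> [i|u] //=; rewrite enum_valK.
  by case=> [i|u] //=; rewrite enum_rankK.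
pose M' x y := M (h (h' x)) (h (h' y)).
apply: (@fe_trans _ (I + 'I_#|J|)%type _ _ M'); last first.
  exact: (fe_iso (bij_comp bh bh')).
rewrite (_ : A = fun i j => M' (inl i) (inl j) +
                   \sum_u M' (inl i) (inr u) * M' (inr u) (inl j)).
  by apply: fe_elim_ord => u u'; apply: M0.
by apply/funext => i; apply/funext => j; rewrite eA -sum_enum_val.
Qed.
End Expand.

(** * Open graphs up to flow equivalence of all their closures *)

(* [adj v w] counts the edges from w to v. The interface is indexed by all of
   [nat]: a morphism n -> m only looks at inputs j < n and outputs k < m, so that
   transporting it along equalities of n and m leaves the graph unchanged. *)
Record ograph := OGraph {
  vtx : finType;
  adj : vtx -> vtx -> nat;
  inp : vtx -> nat -> nat;
  outp : nat -> vtx -> nat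
}.

Definition plug n m (r c : ograph) (x y : vtx r + vtx c) : nat :=
  match x, y with
  | inl v, inl w => adj v w
  | inl v, inr q => \sum_(j < n) inp v j * outp j q
  | inr p, inl w => \sum_(k < m) inp p k * outp k w
  | inr p, inr q => adj p q
  end.

Definition obs n m (r r' : ograph) : Prop :=
  forall c, fe (@plug n m r c) (@plug n m r' c).

Lemma obs_refl n m r : obs n m r r.
Proof. by move=> c; apply: flow_refl. Qed.

Lemma obs_sym n m r r' : obs n m r r' -> obs n m r' r.
Proof. by move=> rr' c; apply: fe_sym. Qed.

Lemma obs_trans n m r1 r2 r3 :
  obs n m r1 r2 -> obs n m r2 r3 -> obs n m r1 r3.
Proof. by move=> r12 r23 c; apply: fe_trans (r12 c) (r23 c). Qed.

(** The workhorse for all laws below: the vertices in [W] are eliminated inside every closure at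
    once. The condition on [inp] and [outp] forbids a vertex of [W] on both interfaces: its removal
    would create an edge between two vertices of the context, that is, a direct feed-through. *)
Lemma obs_elim n m (r' r : ograph) (W : finType) (h : vtx r' + W -> vtx r) :
  bijective h ->
  (forall u u', adj (h (inr u)) (h (inr u')) = 0) ->
  (forall u j k, j < n -> k < m -> inp (h (inr u)) j * outp k (h (inr u)) = 0) ->
  (forall v w, adj v w = adj (h (inl v)) (h (inl w)) +
     \sum_u adj (h (inl v)) (h (inr u)) * adj (h (inr u)) (h (inl w))) ->
  (forall v j, j < n -> inp v j = inp (h (inl v)) j +
     \sum_u adj (h (inl v)) (h (inr u)) * inp (h (inr u)) j) ->
  (forall k w, k < m -> outp k w = outp k (h (inl w)) +
     \sum_u outp k (h (inr u)) * adj (h (inr u)) (h (inl w))) ->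
  obs n m r' r.
Proof.
case=> g hK gK hA0 hIO hA hI hO c.
pose h' (x : vtx r' + vtx c + W) : vtx r + vtx c :=
  match x with inl (inl v) => inl (h (inl v)) | inl (inr p) => inr p
             | inr u => inl (h (inr u)) end.
apply: (fe_elim (h := h')).
- exists (fun x => match x with
    | inl v => match g v with inl v' => inl (inl v') | inr u => inr u end
    | inr p => inl (inr p) end).
    by case=> [[v|p]|u] //=; rewrite hK.
  by case=> [v|p] //=; case E: (g v) => [v'|u] /=; rewrite -E gK.
- by [].
- case=> [v|p] [w|q] //=.
  + under [X in _ = _ + X]eq_bigr => u _ do rewrite big_distrr.
    rewrite exchange_big -big_split /=; apply: eq_bigr => j _.
    rewrite hI // mulnDl big_distrl /=; congr (_ + _).
    by apply: eq_bigr => u _; rewrite mulnA.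
  + under [X in _ = _ + X]eq_bigr => u _ do rewrite big_distrl.
    rewrite exchange_big -big_split /=; apply: eq_bigr => k _.
    rewrite hO // mulnDr big_distrr /=; congr (_ + _).
    by apply: eq_bigr => u _; rewrite mulnA.
  + rewrite big1 ?addn0 // => u _.
    rewrite big_distrlr big1 //= => k _; rewrite big1 // => j _.
    have /eqP := hIO u j k (ltn_ord j) (ltn_ord k).
    by rewrite muln_eq0 => /orP[] /eqP ->; rewrite ?(muln0, mul0n).
Qed.

Lemma obs_iso n m (r' r : ograph) (h : vtx r' -> vtx r) :
  bijective h ->
  (forall v w, adj v w = adj (h v) (h w)) ->
  (forall v j, j < n -> inp v j = inp (h v) j) ->
  (forall k w, k < m -> outp k w = outp k (h w)) ->
  obs n m r' r.
Proof.
case=> g hK gK hA hI hO.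
apply: (@obs_elim _ _ _ _ void
  (fun x => match x with inl v => h v | inr u => match u with end end)) => //.
- by exists (inl \o g) => [[v|[]]|v] /=; rewrite ?hK ?gK.
- by move=> v w; rewrite big_void addn0.
- by move=> v w jn; rewrite big_void addn0 hI.
- by move=> v w jn; rewrite big_void addn0 hO.
Qed.

(** * Operations on open graphs *)

Definition cat_at (n : nat) (X Y : nat -> nat) (j : nat) : nat :=
  if j < n then X j else Y (j - n).

Lemma cat_atl n X Y j : j < n -> cat_at n X Y j = X j.
Proof. by rewrite /cat_at => ->. Qed.

Lemma cat_atr n X Y j : cat_at n X Y (n + j) = Y j.
Proof. by rewrite /cat_at ltnNge leq_addr /= addKn. Qed.

Lemma sum_catl n p X Y (F : 'I_(n + p) -> nat) :
  \sum_(j < n + p) cat_at n X Y j * F j =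
  \sum_(j < n) X j * F (lshift p j) + \sum_(j < p) Y j * F (rshift n j).
Proof.
rewrite big_split_ord; congr (_ + _); apply: eq_bigr => j _ /=.
  by rewrite cat_atl.
by rewrite cat_atr.
Qed.

Lemma sum_catr n p X Y (F : 'I_(n + p) -> nat) :
  \sum_(j < n + p) F j * cat_at n X Y j =
  \sum_(j < n) F (lshift p j) * X j + \sum_(j < p) F (rshift n j) * Y j.
Proof.
under eq_bigr do rewrite mulnC.
by rewrite sum_catl; congr (_ + _); apply: eq_bigr => j _; rewrite mulnC.
Qed.

Lemma sum_cat n p X Y X' Y' :
  \sum_(j < n + p) cat_at n X Y j * cat_at n X' Y' j =
  \sum_(j < n) X j * X' j + \sum_(j < p) Y j * Y' j.
Proof.
rewrite sum_catl; congr (_ + _); apply: eq_bigr => j _ /=.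
  by rewrite cat_atl.
by rewrite cat_atr.
Qed.

Definition rcomp m (g f : ograph) : ograph := @OGraph (vtx f + vtx g)%type
  (fun x y => match x, y with
     | inl v, inl w => adj v w
     | inl _, inr _ => 0
     | inr v, inl w => \sum_(k < m) inp v k * outp k w
     | inr v, inr w => adj v w end)
  (fun x j => if x is inl v then inp v j else 0)
  (fun k x => if x is inr v then outp k v else 0).

Definition rtens n m (f g : ograph) : ograph := @OGraph (vtx f + vtx g)%type
  (fun x y => match x, y with
     | inl v, inl w => adj v w
     | inr v, inr w => adj v w
     | _, _ => 0 end)
  (fun x => match x with inl v => cat_at n (inp v) (fun=> 0)
                       | inr v => cat_at n (fun=> 0) (inp v) end)
  (fun k x => match x with inl v => cat_at m (fun i => outp i v) (fun=> 0) k
                         | inr v => cat_at m (fun=> 0) (fun i => outp i v) k end).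

Definition rtr p (r : ograph) : ograph := @OGraph (vtx r)
  (fun v w => adj v w + \sum_(k < p) inp v k * outp k w)
  (fun v j => inp v (p + j))
  (fun k v => outp (p + k) v).

(** As an input may not reach an output directly, each of the [n] inputs gets a vertex of its own
    and the coefficients sit on the output side. *)
Definition rmat n (D : nat -> nat -> nat) : ograph := @OGraph 'I_n
  (fun _ _ => 0)
  (fun v j => (v == j :> nat))
  (fun k v => D k v).

Definition rid n := rmat n (fun k j => k == j).

Lemma big_mul0n (I : finType) (F : I -> nat) : \sum_i 0 * F i = 0.
Proof. exact: big1. Qed.

Lemma big_muln0 (I : finType) (F : I -> nat) : \sum_i F i * 0 = 0.
Proof. by rewrite big1 // => i _; rewrite muln0. Qed.

(** * Compatibility of the operations with observational equivalence *)

Lemma bij_sumA A B C : bijective (fun x : A + B + C =>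
  match x with inl (inl a) => inl a | inl (inr b) => inr (inl b)
             | inr c => inr (inr c) end).
Proof.
exists (fun x => match x with inl a => inl (inl a)
  | inr (inl b) => inl (inr b) | inr (inr c) => inr c end).
  by case=> [[]|].
by case=> [|[]].
Qed.

Lemma bij_sumACr A B C : bijective (fun x : A + B + C =>
  match x with inl (inl a) => inr (inr a) | inl (inr b) => inl b
             | inr c => inr (inl c) end).
Proof.
exists (fun x => match x with inl b => inl (inr b)
  | inr (inl c) => inr c | inr (inr a) => inl (inl a) end).
  by case=> [[]|].
by case=> [|[]].
Qed.

Lemma bij_sumCA A B C : bijective (fun x : A + B + C =>
  match x with inl (inl a) => inr (inl a) | inl (inr b) => inl b
             | inr c => inr (inr c) end).
Proof.
exists (fun x => match x with inl b => inl (inr b)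
  | inr (inr c) => inr c | inr (inl a) => inl (inl a) end).
  by case=> [[]|].
by case=> [|[]].
Qed.

(** The other factor is absorbed into the context: [g] after [f] plugged into [c] is, up to
    rebracketing of the vertices, [f] plugged into [c] after [g]. The other congruences follow the
    same pattern. *)
Lemma obs_compr n m p f f' g : obs n m f f' ->
  obs n p (rcomp m g f) (rcomp m g f').
Proof.
have H f1 c : fe (@plug n p (rcomp m g f1) c) (@plug n m f1 (rcomp p c g)).
  apply: (fe_iso (bij_sumA _ _ _)).
  case=> [[v|v]|v] [[w|w]|w] //=; by rewrite ?big_mul0n ?big_muln0.
move=> ff' c; apply: fe_trans (H _ _) _; apply: fe_trans (ff' _) _.
exact/fe_sym/H.
Qed.

Lemma obs_compl n m p f g g' : obs m p g g' ->
  obs n p (rcomp m g f) (rcomp m g' f).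
Proof.
have H g1 c : fe (@plug n p (rcomp m g1 f) c) (@plug m p g1 (rcomp n f c)).
  apply: (fe_iso (bij_sumACr _ _ _)).
  case=> [[v|v]|v] [[w|w]|w] //=; by rewrite ?big_mul0n ?big_muln0.
move=> gg' c; apply: fe_trans (H _ _) _; apply: fe_trans (gg' _) _.
exact/fe_sym/H.
Qed.

Lemma obs_tensl n m n' m' f f' g : obs n m f f' ->
  obs (n + n') (m + m') (rtens n m f g) (rtens n m f' g).
Proof.
(* The context seen by [f]: [c] with its last [n'] outputs and last [m'] inputs wired to [g]. *)
pose D c := @OGraph (vtx g + vtx c)%type
  (fun x y => match x, y with
     | inl v, inl w => adj v w
     | inl v, inr q => \sum_(j < n') inp v j * outp (n + j) q
     | inr p, inl w => \sum_(k < m') inp p (m + k) * outp k w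
     | inr p, inr q => adj p q end)
  (fun x k => match x with inl _ => 0 | inr p => inp p k end)
  (fun j x => match x with inl _ => 0 | inr p => outp j p end).
have H f1 c : fe (@plug (n + n') (m + m') (rtens n m f1 g) c) (@plug n m f1 (D c)).
  apply: (fe_iso (bij_sumA _ _ _)).
  case=> [[v|v]|v] [[w|w]|w] //=; rewrite ?sum_catl ?sum_catr /=;
    by rewrite ?big_mul0n ?big_muln0 ?addn0.
move=> ff' c; apply: fe_trans (H _ _) _; apply: fe_trans (ff' _) _.
exact/fe_sym/H.
Qed.

Lemma obs_tensr n m n' m' f g g' : obs n' m' g g' ->
  obs (n + n') (m + m') (rtens n m f g) (rtens n m f g').
Proof.
pose D c := @OGraph (vtx f + vtx c)%type
  (fun x y => match x, y with
     | inl v, inl w => adj v w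
     | inl v, inr q => \sum_(j < n) inp v j * outp j q
     | inr p, inl w => \sum_(k < m) inp p k * outp k w
     | inr p, inr q => adj p q end)
  (fun x k => match x with inl _ => 0 | inr p => inp p (m + k) end)
  (fun j x => match x with inl _ => 0 | inr p => outp (n + j) p end).
have H g1 c : fe (@plug (n + n') (m + m') (rtens n m f g1) c) (@plug n' m' g1 (D c)).
  apply: (fe_iso (bij_sumCA _ _ _)).
  case=> [[v|v]|v] [[w|w]|w] //=; rewrite ?sum_catl ?sum_catr /=;
    by rewrite ?big_mul0n ?big_muln0 ?addn0.
move=> gg' c; apply: fe_trans (H _ _) _; apply: fe_trans (gg' _) _.
exact/fe_sym/H.
Qed.

Lemma sum_ord_deltal n (i : 'I_n) (F : 'I_n -> nat) :
  \sum_(j < n) (i == j :> nat) * F j = F i.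
Proof.
by rewrite -[RHS]sum_delta; apply: eq_bigr => j _; rewrite [j == i]eq_sym.
Qed.

Lemma sum_ord_deltar n (i : 'I_n) (F : 'I_n -> nat) :
  \sum_(j < n) F j * (j == i :> nat) = F i.
Proof. by rewrite -[RHS]sum_delta; apply: eq_bigr => j _; rewrite mulnC. Qed.

(** Closing [rtr p r] by [c] amounts to closing [r] by [id_p] tensored with [c]: eliminating the [p]
    vertices of that identity produces exactly the edges that the trace adds. *)
Lemma obs_tr n m p r r' : obs (p + n) (p + m) r r' ->
  obs n m (rtr p r) (rtr p r').
Proof.
have H r1 c :
  fe (@plug n m (rtr p r1) c) (@plug (p + n) (p + m) r1 (rtens p p (rid p) c)).
  apply: (fe_elim (J := 'I_p) (h := fun x => match x with
     | inl (inl v) => inl v | inl (inr q) => inr (inr q) | inr u => inr (inl u) end)).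
  - exists (fun x => match x with
     | inl v => inl (inl v) | inr (inr q) => inl (inr q) | inr (inl u) => inr u end).
      by case=> [[]|].
    by case=> [|[]].
  - by [].
  case=> [v|v] [w|w] //=; rewrite ?sum_catl ?sum_catr.
  - congr (_ + _); apply: eq_bigr => u _.
    rewrite sum_catl sum_catr !big_muln0 ?big_mul0n !addn0.
    by rewrite sum_ord_deltar sum_ord_deltal.
  - by rewrite !big_muln0 add0n addn0.
  - by rewrite !big_mul0n add0n addn0.
  - by rewrite big_mul0n addn0.
move=> rr' c; apply: fe_trans (H _ _) _; apply: fe_trans (rr' _) _.
exact/fe_sym/H.
Qed.


Lemma sum_cat_ltl n X Y (F : 'I_n -> nat) :
  \sum_(j < n) cat_at n X Y j * F j = \sum_(j < n) X j * F j.
Proof. by apply: eq_bigr => j _; rewrite cat_atl. Qed.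

Lemma sum_cat_ltr n X Y (F : 'I_n -> nat) :
  \sum_(j < n) F j * cat_at n X Y j = \sum_(j < n) F j * X j.
Proof. by apply: eq_bigr => j _; rewrite cat_atl. Qed.

Lemma sum_eq_nat n i (F : nat -> nat) : i < n ->
  \sum_(j < n) (i == j) * F j = F i.
Proof. by move=> lt_in; rewrite (sum_ord_deltal (Ordinal lt_in)). Qed.

Lemma sum_eq_natr n i (F : nat -> nat) : i < n ->
  \sum_(j < n) F j * (j == i :> nat) = F i.
Proof. by move=> lt_in; rewrite (sum_ord_deltar (Ordinal lt_in)). Qed.

(** * Prop laws for open graphs and for matrices among them *)

Definition rpost m (D : nat -> nat -> nat) f : ograph :=
  @OGraph (vtx f) (@adj f) (@inp f)
  (fun k w => \sum_(j < m) D k j * outp j w).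

Definition rpre n f (D : nat -> nat -> nat) : ograph := @OGraph (vtx f) (@adj f)
  (fun v j => \sum_(k < n) inp v k * D k j) (@outp f).

(** The vertices of [rmat] have no edges among themselves and receive no input of the composite, so
    they can be eliminated; the matrix then only transforms the output interface. [obs_pre] is the
    dual statement for inputs. *)
Lemma obs_post n m p D f : obs n p (rcomp m (rmat m D) f) (rpost m D f).
Proof.
apply: obs_sym; apply: (@obs_elim _ _ (rpost m D f) (rcomp m _ f) _ id) => //=.
- by exists id.
- by move=> v w; rewrite big_mul0n addn0.
- by move=> v j _; rewrite big_mul0n addn0.
move=> k w _; rewrite add0n; apply: eq_bigr => u _.
by rewrite (sum_ord_deltal u).
Qed.

Lemma obs_pre n n' p D f : obs n p (rcomp n' f (rmat n D)) (rpre n' f D).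
Proof.
apply: obs_sym; apply: (@obs_elim _ _ (rpre n' f D) (rcomp n' f (rmat n D)) 'I_n
  (fun x => match x with inl v => inr v | inr v => inl v end)) => //=.
- by exists (fun x => match x with inl v => inr v | inr v => inl v end); case.
- by move=> u j k _ _; rewrite muln0.
- by move=> v w; rewrite big_muln0 addn0.
- move=> v j jn; rewrite add0n.
  by rewrite (sum_eq_natr (fun u => \sum_(k < n') inp v k * D k u)).
- by move=> k w _; rewrite big_mul0n addn0.
Qed.

Lemma obs_comp1r n p f : obs n p (rcomp n f (rid n)) f.
Proof.
apply: obs_trans (obs_pre _ _ _ _ _) _.
apply: (@obs_iso _ _ (rpre n f _) f (@id (vtx f))) => //=.
  by exists id.
by move=> v j jn; rewrite (sum_eq_natr (fun j => inp v j)).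
Qed.

Lemma obs_comp1 n m f : obs n m (rcomp m (rid m) f) f.
Proof.
apply: obs_trans (obs_post _ _ _ _ _) _.
apply: (@obs_iso _ _ (rpost m _ f) f (@id (vtx f))) => //=.
  by exists id.
by move=> k w km; rewrite (sum_eq_nat (fun j => outp j w)).
Qed.

Lemma obs_compA n m p q h g f :
  obs n q (rcomp m (rcomp p h g) f) (rcomp p h (rcomp m g f)).
Proof.
apply: obs_sym; apply: (@obs_iso _ _ (rcomp p h (rcomp m g f))
  (rcomp m (rcomp p h g) f) _ (bij_sumA _ _ _)) => //=.
- case=> [[v|v]|v] [[w|w]|w] //=; by rewrite ?big_mul0n ?big_muln0.
- by case=> [[v|v]|v].
- by move=> ? [[v|v]|v].
Qed.

Lemma bij_sumACA A B C D : bijective (fun x : (A + B) + (C + D) =>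
  match x with inl (inl a) => inl (inl a) | inl (inr b) => inr (inl b)
             | inr (inl c) => inl (inr c) | inr (inr d) => inr (inr d) end).
Proof.
exists (fun x => match x with inl (inl a) => inl (inl a) | inr (inl b) => inl (inr b)
             | inl (inr c) => inr (inl c) | inr (inr d) => inr (inr d) end).
  by case=> [[]|[]].
by case=> [[]|[]].
Qed.

Lemma obs_tens_comp n m p n' m' p' g f g' f' :
  obs (n + n') (p + p') (rtens n p (rcomp m g f) (rcomp m' g' f'))
    (rcomp (m + m') (rtens m p g g') (rtens n m f f')).
Proof.
apply: (@obs_iso _ _ (rtens n p (rcomp m g f) (rcomp m' g' f'))
  (rcomp (m + m') (rtens m p g g') (rtens n m f f')) _ (bij_sumACA _ _ _ _)) => //=.
- case=> [[v|v]|[v|v]] [[w|w]|[w|w]] //=; rewrite sum_cat;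
    by rewrite ?big_mul0n ?big_muln0 ?addn0.
- by case=> [[v|v]|[v|v]] j jn //=; rewrite /cat_at; case: ifP.
- by move=> k [[v|v]|[v|v]] kn //=; rewrite /cat_at; case: ifP.
Qed.

Lemma obs_tensA n m n' m' n'' m'' f g h :
  obs (n + n' + n'') (m + m' + m'')
    (rtens n m f (rtens n' m' g h)) (rtens (n + n') (m + m') (rtens n m f g) h).
Proof.
have catA a b x X Y Z : cat_at a X (cat_at b Y Z) x =
    cat_at (a + b) (cat_at a X Y) Z x.
  rewrite /cat_at; case: (ltnP x a) => xa.
    by rewrite (leq_trans xa) ?leq_addr.
  by rewrite ltn_subLR // subnDA.
have cat00 a x : cat_at a (fun=> 0) (fun=> 0) x = 0.
  by rewrite /cat_at; case: ifP.
apply: obs_sym; apply: (@obs_iso _ _ (rtens (n + n') (m + m') (rtens n m f g) h)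
  (rtens n m f (rtens n' m' g h)) _ (bij_sumA _ _ _)) => //=.
- by case=> [[v|v]|v] [[w|w]|w].
- case=> [[v|v]|v] j _ //=; rewrite ?catA //; rewrite /cat_at;
    repeat case: ifP => //; lia.
- move=> k [[v|v]|v] _ //=; rewrite ?catA //; rewrite /cat_at;
    repeat case: ifP => //; lia.
Qed.

Lemma obs_tens1 n m f : obs n m (rtens 0 0 (rid 0) f) f.
Proof.
apply: obs_sym; apply: (@obs_iso _ _ f (rtens 0 0 (rid 0) f) inr) => //=.
- exists (fun x : 'I_0 + vtx f => match x with
    inl u => match notF (ltn_ord u) with end | inr v => v end) => //.
  by case=> [[]|].
- by move=> v j _; rewrite /cat_at subn0.
- by move=> k w _; rewrite /cat_at subn0.
Qed.

Lemma obs_tens1r n m f : obs n m (rtens n m f (rid 0)) f.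
Proof.
apply: obs_sym; apply: (@obs_iso _ _ f (rtens n m f (rid 0)) inl) => //=.
- exists (fun x : vtx f + 'I_0 => match x with
    inr u => match notF (ltn_ord u) with end | inl v => v end) => //.
  by case=> [|[]].
- by move=> v j jn; rewrite cat_atl.
- by move=> k w kn; rewrite cat_atl.
Qed.

(** Extension by zero, to fit interfaces indexed by all of [nat]; the default value lies beyond the
    interface. *)
Definition nmx m n (D : 'M[nat]_(m, n)) (k j : nat) : nat :=
  match insub k, insub j with Some k', Some j' => D k' j' | _, _ => 0 end.

Lemma nmxE m n (D : 'M[nat]_(m, n)) (k : 'I_m) (j : 'I_n) : nmx D k j = D k j.
Proof. by rewrite /nmx !valK. Qed.

Definition reta m n (D : 'M[nat]_(m, n)) := rmat n (nmx D).

Lemma obs_eta1 n : obs n n (reta (1%:M : 'M[nat]_n)%R) (rid n).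
Proof.
apply: (@obs_iso _ _ (reta (1%:M : 'M[nat]_n)%R) (rid n) (@id 'I_n)) => //=.
  by exists id.
move=> k w kn; rewrite -[k]/(nat_of_ord (Ordinal kn)) nmxE mxE -val_eqE /=.
by case: eqP.
Qed.

Lemma obs_eta_comp n m p (D : 'M[nat]_(m, n)) (E : 'M[nat]_(p, m)) :
  obs n p (reta (E *m D)%R) (rcomp m (reta E) (reta D)).
Proof.
apply: obs_sym; apply: obs_trans (obs_post _ _ _ _ _) _.
apply: (@obs_iso _ _ (rpost m _ (reta D)) (reta (E *m D)%R) (@id 'I_n)) => //=.
  by exists id.
move=> k w kp; rewrite -[k]/(nat_of_ord (Ordinal kp)) nmxE mxE.
by apply: eq_bigr => j _; rewrite !nmxE.
Qed.

Lemma obs_eta_tens n m n' m' (D : 'M[nat]_(m, n)) (E : 'M[nat]_(m', n')) :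
  obs (n + n') (m + m') (reta (block_mx D 0 0 E)%R) (rtens n m (reta D) (reta E)).
Proof.
apply: obs_sym; apply: (@obs_iso _ _ (rtens n m (reta D) (reta E))
  (reta (block_mx D 0 0 E)%R) (@unsplit n n')) => //=.
- by exists (@split n n'); [apply: unsplitK | apply: splitK].
- by case=> v [w|w].
- case=> v j jn /=; rewrite /cat_at; case: ltnP => // H; apply/esym.
  + by rewrite ltn_eqF // (leq_trans (ltn_ord v)).
  + by rewrite gtn_eqF // (leq_trans H) ?leq_addr.
  + by rewrite -[in LHS](subnKC H) eqn_add2l.
move=> k w km; rewrite -[k]/(nat_of_ord (Ordinal km)) nmxE.
rewrite -[Ordinal km]splitK; case: (split _) => l; case: w => w /=.
- by rewrite cat_atl // block_mxEul nmxE.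
- by rewrite cat_atl // block_mxEur mxE.
- by rewrite cat_atr block_mxEdl mxE.
- by rewrite cat_atr block_mxEdr nmxE.
Qed.

(** * Trace laws for open graphs *)

Definition rsw n m := reta (mat_sw nat n m).

Lemma nmx_sw n m k j : k < m + n -> j < n + m ->
  nmx (mat_sw nat n m) k j = cat_at m (fun k => j == n + k) (fun k => j == k) k.
Proof.
move=> km jn; rewrite -[k]/(nat_of_ord (Ordinal km)) -[j]/(nat_of_ord (Ordinal jn)).
rewrite nmxE -[Ordinal km]splitK -[Ordinal jn]splitK /mat_sw.
case: (split (Ordinal km)) => x; case: (split (Ordinal jn)) => y /=;
  rewrite ?cat_atr ?cat_atl ?block_mxEul ?block_mxEur ?block_mxEdl ?block_mxEdr //.
- by rewrite mxE ltn_eqF // (leq_trans (ltn_ord y)) ?leq_addr.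
- by rewrite mxE eqn_add2l -val_eqE /= eq_sym; case: (_ == _).
- by rewrite mxE -val_eqE /= eq_sym; case: (_ == _).
- by rewrite mxE gtn_eqF // (leq_trans (ltn_ord x)) ?leq_addr.
Qed.

Lemma sum_sw_out n m k (F : nat -> nat) : k < m + n ->
  \sum_(j < n + m) nmx (mat_sw nat n m) k j * F j =
  cat_at m (fun k => F (n + k)) F k.
Proof.
move=> km; under eq_bigr => j _ do rewrite nmx_sw //.
rewrite /cat_at; case: ltnP => H.
  under eq_bigr => j _ do rewrite eq_sym.
  by rewrite sum_eq_nat // ltn_add2l.
under eq_bigr => j _ do rewrite eq_sym.
by rewrite sum_eq_nat // ltn_subLR // (leq_trans km) // addnA leq_addr.
Qed.

Lemma sum_sw_in n m j (F : nat -> nat) : j < n + m ->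
  \sum_(k < m + n) F k * nmx (mat_sw nat n m) k j =
  cat_at n (fun j => F (m + j)) F j.
Proof.
move=> jn; under eq_bigr => k _ do rewrite nmx_sw //.
rewrite sum_catr /= /cat_at; case: ltnP => H.
  rewrite big1 ?add0n.
    under eq_bigr => k _ do rewrite eq_sym.
    by rewrite (sum_eq_natr (fun j => F (m + j))).
  by move=> k _; rewrite ltn_eqF ?muln0 // (leq_trans H) ?leq_addr.
rewrite addnC big1 ?add0n.
  under eq_bigr => k _.
    rewrite -[X in X == _](subnKC H) eqn_add2l eq_sym; over.
  by rewrite sum_eq_natr // ltn_subLR.
by move=> k _; rewrite gtn_eqF ?muln0 // (leq_trans (ltn_ord k)).
Qed.

Lemma bij_sumC A B : bijective (fun x : A + B =>
  match x with inl a => inr a | inr b => inl b end).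
Proof.
by exists (fun x => match x with inl a => inr a | inr b => inl b end); case.
Qed.

Lemma cat_swap n n' X Y j : j < n + n' ->
  cat_at n (fun j => cat_at n' Y X (n' + j)) (cat_at n' Y X) j = cat_at n X Y j.
Proof.
move=> jn; case: (ltnP j n) => H; first by rewrite !(cat_atl _ _ H) cat_atr.
by rewrite -{1 2}(subnKC H) !cat_atr cat_atl // ltn_subLR.
Qed.

(** Eliminating the vertices of the symmetries leaves, on both sides, the disjoint union of [f] and
    [g], with outputs permuted on the left and inputs on the right. Exchanging the two summands
    matches them. *)
Lemma obs_sw_nat n m n' m' f g :
  obs (n + n') (m' + m) (rcomp (m + m') (rsw m m') (rtens n m f g))
    (rcomp (n' + n) (rtens n' m' g f) (rsw n n')).
Proof.
apply: obs_trans (obs_post _ _ _ _ _) _.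
apply: obs_trans (obs_sym (obs_pre _ _ _ _ _)).
apply: (@obs_iso _ _ (rpost (m + m') _ (rtens n m f g))
  (rpre (n' + n) (rtens n' m' g f) _) _ (bij_sumC _ _)) => //=.
- by case=> v [w|w].
- case=> v j jn /=.
    by rewrite (sum_sw_in (cat_at n' (fun=> 0) (inp v))) // cat_swap.
  by rewrite (sum_sw_in (cat_at n' (inp v) (fun=> 0))) // cat_swap.
- move=> k [] v km /=.
    rewrite (sum_sw_out (cat_at m (fun i => outp i v) (fun=> 0))) //.
    by rewrite cat_swap.
  rewrite (sum_sw_out (cat_at m (fun=> 0) (fun i => outp i v))) //.
  by rewrite cat_swap.
Qed.

(* [rpost_tail] and [rpre_tail] are (id_p (x) g) o f and f o (id_p (x) h) with the
   p vertices of the identity eliminated. *)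
Definition rpost_tail p m g f : ograph := @OGraph (vtx f + vtx g)%type
  (fun x y => match x, y with
     | inl v, inl w => adj v w
     | inl _, inr _ => 0
     | inr v, inl w => \sum_(k < m) inp v k * outp (p + k) w
     | inr v, inr w => adj v w end)
  (fun x j => match x with inl v => inp v j | inr _ => 0 end)
  (fun k x => match x with inl v => cat_at p (fun i => outp i v) (fun=> 0) k
                      | inr v => cat_at p (fun=> 0) (fun i => outp i v) k end).

Definition rpre_tail p n f h : ograph := @OGraph (vtx h + vtx f)%type
  (fun x y => match x, y with
     | inl v, inl w => adj v w
     | inl _, inr _ => 0
     | inr v, inl w => \sum_(k < n) inp v (p + k) * outp k w
     | inr v, inr w => adj v w end)
  (fun x => match x with inl v => cat_at p (fun=> 0) (inp v)
                      | inr v => cat_at p (inp v) (fun=> 0) end)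
  (fun k x => match x with inl v => 0 | inr v => outp k v end).

Lemma obs_post_tail p n m n' f g :
  obs n (p + n') (rcomp (p + m) (rtens p p (rid p) g) f) (rpost_tail p m g f).
Proof.
apply: obs_sym.
apply: (@obs_elim _ _ (rpost_tail p m g f)
  (rcomp (p + m) (rtens p p (rid p) g) f) 'I_p
  (fun x => match x with inl (inl v) => inl v | inl (inr v) => inr (inr v)
                     | inr u => inr (inl u) end)) => //=.
- exists (fun x => match x with inl v => inl (inl v)
    | inr (inr v) => inl (inr v) | inr (inl u) => inr u end).
    by case=> [[]|].
  by case=> [|[]].
- case=> [v|v] [w|w] //=; rewrite ?sum_catl /=;
    by rewrite ?big_mul0n ?big_muln0 ?addn0 ?add0n.
- by case=> [v|v] j _; rewrite big_mul0n addn0.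
- move=> k [v|v] kp; last by rewrite big_muln0 addn0.
  rewrite add0n; under eq_bigr => u _.
    rewrite sum_catl /= big_mul0n addn0 (sum_ord_deltal u); over.
  rewrite /cat_at; case: ltnP => H; last by rewrite big_mul0n.
  by rewrite (sum_eq_nat (fun i => outp i v)).
Qed.

Lemma obs_pre_tail p n n' m f h :
  obs (p + n') m (rcomp (p + n) f (rtens p p (rid p) h)) (rpre_tail p n f h).
Proof.
apply: obs_sym.
apply: (@obs_elim _ _ (rpre_tail p n f h)
  (rcomp (p + n) f (rtens p p (rid p) h)) 'I_p
  (fun x => match x with inl (inl v) => inl (inr v) | inl (inr v) => inr v
                     | inr u => inl (inl u) end)) => //=.
- exists (fun x => match x with inl (inr v) => inl (inl v)
    | inr v => inl (inr v) | inl (inl u) => inr u end).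
    by case=> [[]|].
  by case=> [[]|].
- by move=> u j k _ _; rewrite muln0.
- case=> [v|v] [w|w] //=; rewrite ?sum_catr /=;
    by rewrite ?big_mul0n ?big_muln0 ?addn0 ?add0n.
- case=> [v|v] j jp; first by rewrite big_mul0n addn0.
  rewrite add0n; under eq_bigr => u _.
    rewrite sum_catr /= big_muln0 addn0.
    rewrite (sum_ord_deltar u) mulnC; over.
  rewrite /cat_at; case: ltnP => H; last by rewrite big_mul0n.
  under eq_bigr => u _ do rewrite mulnC.
  by rewrite (sum_eq_natr (fun i => inp v i)).
- by move=> k [v|v] kk; rewrite big_mul0n ?addn0.
Qed.

(** Once the identity vertices are gone, both graphs have the same vertices, and the traced wires
    touch only those of [f]. *)
Lemma obs_tighten_post p n m n' f g :
  obs n n' (rtr p (rcomp (p + m) (rtens p p (rid p) g) f)) (rcomp m g (rtr p f)).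
Proof.
apply: obs_trans (obs_tr (obs_post_tail _ _ _ _ _ _)) _.
apply: (@obs_iso _ _ (rtr p (rpost_tail p m g f)) (rcomp m g (rtr p f)) id) => //=.
- by exists id.
- case=> [v|v] [w|w] //=; rewrite ?sum_cat_ltr;
    by rewrite ?big_mul0n ?big_muln0 ?addn0 ?add0n.
- by move=> k [v|v] _; rewrite cat_atr.
Qed.

Lemma obs_tighten_pre p n m n' f h :
  obs n' m (rtr p (rcomp (p + n) f (rtens p p (rid p) h))) (rcomp n (rtr p f) h).
Proof.
apply: obs_trans (obs_tr (obs_pre_tail _ _ _ _ _ _)) _.
apply: (@obs_iso _ _ (rtr p (rpre_tail p n f h)) (rcomp n (rtr p f) h) id) => //=.
- by exists id.
- case=> [v|v] [w|w] //=; rewrite ?sum_cat_ltl;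
    by rewrite ?big_mul0n ?big_muln0 ?addn0 ?add0n.
- by move=> [v|v] j _; rewrite cat_atr.
Qed.

Lemma obs_strength p n m n' m' f g :
  obs (n + n') (m + m') (rtr p (rtens (p + n) (p + m) f g))
    (rtens n m (rtr p f) g).
Proof.
have catD X Y j n0 : cat_at (p + n0) X Y (p + j) = cat_at n0 (fun j => X (p + j)) Y j.
  by rewrite /cat_at ltn_add2l subnDl.
apply: (@obs_iso _ _ (rtr p (rtens (p + n) (p + m) f g))
  (rtens n m (rtr p f) g) id) => //=.
- by exists id.
- have catp X Y k n0 : k < p -> cat_at (p + n0) X Y k = X k.
    by move=> kp; rewrite cat_atl // (leq_trans kp) ?leq_addr.
  case=> [v|v] [w|w] //=.
  + by congr (_ + _); apply: eq_bigr => k _; rewrite !catp.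
  + by rewrite big1 // => k _; rewrite !catp // muln0.
  + by rewrite big1 // => k _; rewrite !catp.
  + by rewrite big1 ?addn0 // => k _; rewrite !catp.
- by case=> v j _ /=; rewrite catD.
- by move=> k [] v _ /=; rewrite catD.
Qed.

(** Tracing the symmetry leaves the path from the input through vertex 1, then vertex 0, to the
    output. Vertex 1 is eliminated and vertex 0 carries the identity. *)
Lemma obs_yank : obs 1 1 (rtr 1 (rsw 1 1)) (rid 1).
Proof.
have sw i j : i < 2 -> j < 2 -> nmx (mat_sw nat 1 1) i j = (i != j).
  by move=> i2 j2; rewrite nmx_sw //; case: i i2 => [|[]]; case: j j2 => [|[]].
apply: obs_sym; apply: (@obs_elim _ _ (rid 1) (rtr 1 (rsw 1 1)) 'I_1
  (@unsplit 1 1)).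
- by exists (@split 1 1); [apply: unsplitK | apply: splitK].
- move=> u u' /=; rewrite big_ord1 !ord1 /= sw //.
- move=> u [|//] [|//] _ _; rewrite !ord1 /= sw //.
- move=> u u' /=; rewrite !big_ord1 !ord1 /= !sw //.
- move=> u [|//] _; rewrite big_ord1 /= !big_ord1 !ord1 /= !sw //.
- move=> [|//] u _; rewrite big_ord1 /= !big_ord1 !ord1 /= !sw //.
Qed.

(* Both sides of the sliding law, with the vertices of the identity eliminated:
   f and g joined in a loop. *)
Definition rloop m n (f g : ograph) := @OGraph (vtx f + vtx g)%type
  (fun x y => match x, y with
     | inl v, inl w => adj v w
     | inl v, inr w => \sum_(k < m) inp v k * outp k w
     | inr v, inl w => \sum_(j < n) inp v j * outp j w
     | inr v, inr w => adj v w end)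
  (fun x j => match x with inl v => inp v (m + j) | inr _ => 0 end)
  (fun k x => match x with inl v => outp (n + k) v | inr _ => 0 end).

Lemma obs_slide_pre m n p q f g :
  obs p q (rtr n (rcomp (m + p) f (rtens n m g (rid p)))) (rloop m n f g).
Proof.
apply: obs_sym; apply: (@obs_elim _ _ (rloop m n f g)
  (rtr n (rcomp (m + p) f (rtens n m g (rid p)))) 'I_p
  (fun x => match x with inl (inl v) => inr v | inl (inr v) => inl (inl v)
                     | inr u => inl (inr u) end)) => //=.
- exists (fun x => match x with inr v => inl (inl v)
    | inl (inl v) => inl (inr v) | inl (inr u) => inr u end).
    by case=> [[]|].
  by case=> [[]|].
- by move=> u u'; rewrite sum_cat_ltl big_mul0n.
- by move=> u j k _ _; rewrite muln0.
- case=> [v|v] [w|w] //=; rewrite ?sum_cat_ltl ?sum_catr /=.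
  + rewrite !big_mul0n !addn0 big1 ?addn0 // => u _.
    by rewrite sum_cat_ltl big_mul0n muln0.
  + rewrite [X in _ + X]big1 => [|u _]; last by rewrite ?big_muln0 !addn0 muln0.
    by rewrite big_muln0 big_mul0n !addn0.
  + rewrite [X in _ + X]big1 => [|u _]; last by rewrite !big_muln0 !addn0 ?mul0n.
    by rewrite add0n addn0.
  + rewrite [X in _ + X]big1 => [|u _]; last by rewrite !big_muln0 !addn0 ?mul0n.
    by rewrite big_muln0 !addn0.
- case=> [v|v] j jp; last first.
    by rewrite cat_atr big1 // => u _; rewrite big_muln0.
  rewrite add0n; under eq_bigr => u _.
    rewrite sum_catr /= big_muln0 big_mul0n addn0 add0n.
    rewrite (sum_ord_deltar u) cat_atr /=; over.
  by rewrite (sum_eq_natr (fun i => inp v (m + i))).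
- by move=> k [v|v] _; rewrite big_mul0n ?addn0.
Qed.

Lemma obs_slide_post m n p q f g :
  obs p q (rtr m (rcomp (n + q) (rtens n m g (rid q)) f)) (rloop m n f g).
Proof.
apply: obs_sym; apply: (@obs_elim _ _ (rloop m n f g)
  (rtr m (rcomp (n + q) (rtens n m g (rid q)) f)) 'I_q
  (fun x => match x with inl (inl v) => inl v | inl (inr v) => inr (inl v)
                     | inr u => inr (inr u) end)) => //=.
- exists (fun x => match x with inl v => inl (inl v)
    | inr (inl v) => inl (inr v) | inr (inr u) => inr u end).
    by case=> [[]|].
  by case=> [|[]].
- by move=> u u'; rewrite big_mul0n.
- case=> [v|v] [w|w] //=; rewrite ?sum_cat_ltr ?sum_catl /=.
  + rewrite [X in _ + X]big1 => [|u _].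
      by rewrite !big_muln0 !addn0.
    by rewrite sum_cat_ltr big_muln0.
  + rewrite [X in _ + X]big1 => [|u _]; last first.
      by rewrite big_mul0n addn0 muln0.
    by rewrite add0n addn0.
  + rewrite [X in _ + X]big1 => [|u _]; last by rewrite !big_mul0n !addn0.
    by rewrite !big_mul0n !addn0.
  + rewrite [X in _ + X]big1 => [|u _]; last by rewrite !big_mul0n !addn0.
    by rewrite !big_mul0n !addn0.
- by case=> [v|v] j jp; rewrite big_muln0 ?addn0.
move=> k [v|v] kq; last first.
  by rewrite cat_atr big1 // => u _; rewrite big_mul0n muln0.
rewrite add0n; under eq_bigr => u _.
  rewrite sum_catl /= big_mul0n big_mul0n addn0 add0n.
  rewrite (sum_ord_deltal u) cat_atr /=; over.
by rewrite (sum_eq_nat (fun i => outp (n + i) v)).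
Qed.

Lemma obs_slide m n p q f g :
  obs p q (rtr n (rcomp (m + p) f (rtens n m g (rid p))))
    (rtr m (rcomp (n + q) (rtens n m g (rid q)) f)).
Proof.
exact: obs_trans (obs_slide_pre _ _ _ _ _ _) (obs_sym (obs_slide_post _ _ _ _ _ _)).
Qed.

(** * The traced prop of open graphs *)

(** The quotient by [obs], encoded by equivalence classes as predicates: extensionality turns [obs]
    into the equality in which the prop laws are stated. *)
Definition ghom (n m : nat) : Type :=
  {S : ograph -> Prop | exists r, S = obs n m r}.

Definition cls n m (r : ograph) : ghom n m :=
  exist _ (obs n m r) (ex_intro _ r erefl).

Lemma cls_eq n m r r' : obs n m r r' -> cls n m r = cls n m r'.
Proof.
move=> rr'; apply: eq_exist => /=.
apply/funext => x; apply/propext; split; apply: obs_trans => //.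
exact: obs_sym.
Qed.

Lemma cls_inj n m r r' : cls n m r = cls n m r' -> obs n m r r'.
Proof. by case=> ->; apply: obs_refl. Qed.

Lemma clsP n m (x : ghom n m) : exists r, x = cls n m r.
Proof. by case: x => S [r eS]; exists r; apply: eq_exist. Qed.

Definition rep n m (x : ghom n m) : ograph := sval (cid (clsP x)).

Lemma obs_rep n m r : obs n m (rep (cls n m r)) r.
Proof. by apply: cls_inj; rewrite /rep; case: cid. Qed.

Definition gcomp n m p (g : ghom m p) (f : ghom n m) : ghom n p :=
  cls n p (rcomp m (rep g) (rep f)).

Definition gtens n m n' m' (f : ghom n m) (g : ghom n' m') :
    ghom (n + n') (m + m') :=
  cls (n + n') (m + m') (rtens n m (rep f) (rep g)).

Definition gtr m n (f : ghom (1 + m) (1 + n)) : ghom m n :=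
  cls m n (rtr 1 (rep f)).

Definition geta n m (D : mat_hom nat n m) : ghom n m := cls n m (reta D).

(** The operations are defined on chosen representatives; by the congruence lemmas they can be
    computed on any. *)
Lemma gcompE n m p g f :
  gcomp (cls m p g) (cls n m f) = cls n p (rcomp m g f).
Proof.
apply: cls_eq; apply: obs_trans (obs_compl _ _ (obs_rep _ _ _)) _.
exact: obs_compr (obs_rep _ _ _).
Qed.

Lemma gtensE n m n' m' f g :
  gtens (cls n m f) (cls n' m' g) = cls (n + n') (m + m') (rtens n m f g).
Proof.
apply: cls_eq; apply: obs_trans (obs_tensl _ _ _ (obs_rep _ _ _)) _.
exact: obs_tensr (obs_rep _ _ _).
Qed.

Lemma gtrE m n f : gtr (cls (1 + m) (1 + n) f) = cls m n (rtr 1 f).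
Proof. by apply: cls_eq; apply: obs_tr; apply: obs_rep. Qed.

Lemma hcast_cls n m n' m' (en : n = n') (em : m = m') r :
  hcast en em (cls n m r) = cls n' m' r.
Proof. by case: n' / en; case: m' / em. Qed.

Lemma hcast_geta n m n' m' (en : n = n') (em : m = m') (D : mat_hom nat n m) :
  hcast en em (geta D) = geta (hcast en em D).
Proof. by case: n' / en; case: m' / em. Qed.

Lemma geta1 n : geta (1%:M : 'M[nat]_n)%R = cls n n (rid n).
Proof. exact/cls_eq/obs_eta1. Qed.

Lemma geta_comp n m p (E : mat_hom nat m p) (D : mat_hom nat n m) :
  geta (mat_comp E D) = gcomp (geta E) (geta D).
Proof. by rewrite gcompE; apply: cls_eq; apply: obs_eta_comp. Qed.

Lemma geta_tens n m n' m' (D : mat_hom nat n m) (E : mat_hom nat n' m') :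
  geta (mat_tens D E) = gtens (geta D) (geta E).
Proof. by rewrite gtensE; apply: cls_eq; apply: obs_eta_tens. Qed.

Lemma gcomp1m n m (f : ghom n m) : gcomp (cls m m (rid m)) f = f.
Proof. by have [r ->] := clsP f; rewrite gcompE; apply/cls_eq/obs_comp1. Qed.

Lemma gcompm1 n m (f : ghom n m) : gcomp f (cls n n (rid n)) = f.
Proof. by have [r ->] := clsP f; rewrite gcompE; apply/cls_eq/obs_comp1r. Qed.

Lemma gcompA n m p q (h : ghom p q) (g : ghom m p) (f : ghom n m) :
  gcomp h (gcomp g f) = gcomp (gcomp h g) f.
Proof.
have [[rh ->] [rg ->] [rf ->]] := And3 (clsP h) (clsP g) (clsP f).
by rewrite !gcompE; apply/cls_eq/obs_sym/obs_compA.
Qed.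

(** Identities and symmetries are images of matrices, so the laws involving only them are inherited
    from the matrix prop through [geta]. *)
Lemma gtens11 n m :
  gtens (cls n n (rid n)) (cls m m (rid m)) = cls (n + m) (n + m) (rid (n + m)).
Proof. by rewrite -!geta1 -geta_tens; congr geta; apply: mat_tens11. Qed.

Lemma gtens_comp n m p n' m' p' (g : ghom m p) (f : ghom n m)
    (g' : ghom m' p') (f' : ghom n' m') :
  gtens (gcomp g f) (gcomp g' f') = gcomp (gtens g g') (gtens f f').
Proof.
have [[rg ->] [rf ->]] := conj (clsP g) (clsP f).
have [[rg' ->] [rf' ->]] := conj (clsP g') (clsP f').
by rewrite !(gcompE, gtensE); apply/cls_eq/obs_tens_comp.
Qed.

Lemma gtensA n m n' m' n'' m'' (f : ghom n m) (g : ghom n' m')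
    (h : ghom n'' m'') :
  hcast (addnA n n' n'') (addnA m m' m'') (gtens f (gtens g h)) =
  gtens (gtens f g) h.
Proof.
have [[rh ->] [rg ->] [rf ->]] := And3 (clsP h) (clsP g) (clsP f).
by rewrite !gtensE hcast_cls; apply/cls_eq/obs_tensA.
Qed.

Lemma gtens1m n m (f : ghom n m) : gtens (cls 0 0 (rid 0)) f = f.
Proof. by have [r ->] := clsP f; rewrite gtensE; apply/cls_eq/obs_tens1. Qed.

Lemma gtensm1 n m (f : ghom n m) :
  hcast (addn0 n) (addn0 m) (gtens f (cls 0 0 (rid 0))) = f.
Proof.
have [r ->] := clsP f; rewrite gtensE hcast_cls.
exact/cls_eq/obs_tens1r.
Qed.

Definition gsw n m : ghom (n + m) (m + n) := geta (mat_sw nat n m).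

Lemma gsw_nat n m n' m' (f : ghom n m) (g : ghom n' m') :
  gcomp (gsw m m') (gtens f g) = gcomp (gtens g f) (gsw n n').
Proof.
have [[rg ->] [rf ->]] := conj (clsP g) (clsP f).
rewrite !gtensE !gcompE; exact/cls_eq/obs_sw_nat.
Qed.

Lemma gswK n m :
  gcomp (gsw m n) (gsw n m) = cls (n + m) (n + m) (rid (n + m)).
Proof. by rewrite -geta_comp mat_swK geta1. Qed.

Lemma gsw0 n : hcast (addn0 n) erefl (gsw n 0) = cls n n (rid n).
Proof. by rewrite hcast_geta mat_sw0 geta1. Qed.

Lemma gswD n m p :
  gsw n (m + p) =
  hcast (esym (addnA n m p)) (addnA m p n)
    (gcomp (gtens (cls m m (rid m)) (gsw n p))
       (hcast erefl (esym (addnA m n p))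
          (gtens (gsw n m) (cls p p (rid p))))).
Proof.
by rewrite -!geta1 -!geta_tens hcast_geta -geta_comp hcast_geta -mat_swD.
Qed.

Definition graph_prop : prop_cat :=
  @PropCat ghom (fun n => cls n n (rid n)) gcomp gtens gsw
    gcomp1m gcompm1 gcompA gtens11 gtens_comp gtensA gtens1m gtensm1
    gsw_nat gswK gsw0 gswD.

Lemma obs_rtr0 n m r : obs n m (rtr 0 r) r.
Proof.
apply: (@obs_iso _ _ (rtr 0 r) r id) => //=; first by exists id.
by move=> v w; rewrite big_ord0 addn0.
Qed.

Lemma obs_rtrS p n m r : obs n m (rtr p (rtr 1 r)) (rtr p.+1 r).
Proof.
apply: (@obs_iso _ _ (rtr p (rtr 1 r)) (rtr p.+1 r) id) => //=.
  by exists id.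
by move=> v w; rewrite big_ord1 [in RHS]big_ord_recl addnA.
Qed.

(** Collapses the iterated single-wire trace of the sliding axiom into the [p]-wire trace for which
    [obs_slide] is proved. *)
Lemma gtrnE p m n r :
  iter_tr gtr (cls (p + m) (p + n) r) = cls m n (rtr p r).
Proof.
elim: p m n r => [|p IH] m n r /=.
  exact/cls_eq/obs_sym/obs_rtr0.
rewrite (gtrE (p + m) (p + n)) IH; exact/cls_eq/obs_rtrS.
Qed.

Lemma gtr_tightening m n m' n' (f : ghom (1 + m) (1 + n)) (g : ghom n n')
    (h : ghom m' m) :
  gtr (gcomp (gcomp (gtens (cls 1 1 (rid 1)) g) f) (gtens (cls 1 1 (rid 1)) h)) =
  gcomp (gcomp g (gtr f)) h.
Proof.
have [[rh ->] [rg ->] [rf ->]] := And3 (clsP h) (clsP g) (clsP f).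
rewrite !gtensE (gtrE m n rf) !gcompE (gtrE m' n'); apply: cls_eq.
apply: obs_trans (obs_tighten_pre _ _ _ _ _ _) _.
exact/obs_compl/obs_tighten_post.
Qed.

Lemma gtr_sliding m n p q (f : ghom (m + p) (n + q)) (g : ghom n m) :
  iter_tr gtr (p := n) (gcomp f (gtens g (cls p p (rid p)))) =
  iter_tr gtr (p := m) (gcomp (gtens g (cls q q (rid q))) f).
Proof.
have [[rg ->] [rf ->]] := conj (clsP g) (clsP f).
by rewrite !gtensE !gcompE !gtrnE; apply/cls_eq/obs_slide.
Qed.

Lemma gtr_strength m n m' n' (f : ghom (1 + m) (1 + n)) (g : ghom m' n') :
  gtr (m := m + m') (n := n + n') (gtens f g) = gtens (gtr f) g.
Proof.
have [[rg ->] [rf ->]] := conj (clsP g) (clsP f).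
by rewrite gtrE !gtensE (gtrE (m + m')); apply/cls_eq/obs_strength.
Qed.

Lemma gtr_yanking : gtr (gsw 1 1) = cls 1 1 (rid 1).
Proof. by rewrite (gtrE 1 1); apply/cls_eq/obs_yank. Qed.

Definition graph_traced : traced_prop :=
  @TracedProp graph_prop gtr gtr_tightening gtr_yanking gtr_sliding gtr_strength.

Definition graph_functor : prop_functor (mat_prop nat) graph_traced :=
  @PropFunctor (mat_prop nat) graph_traced geta geta1 geta_comp geta_tens
    (fun _ _ => erefl).

(** Separation of flow classes: tracing all wires of the graph of [K] leaves one vertex per index,
    with adjacency [K]. Plugging into the empty graph [rid 0] therefore turns observational
    equivalence into flow equivalence of the matrices. *)
Lemma closed_trace_flow m n (M : 'M[nat]_m) (N : 'M[nat]_n) :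
  closed_trace (fmap graph_functor (M : phom (mat_prop nat) m m)) =
  closed_trace (fmap graph_functor (N : phom (mat_prop nat) n n)) ->
  flow_equiv M N.
Proof.
have closedE k (K : 'M[nat]_k) :
    closed_trace (fmap graph_functor (K : phom (mat_prop nat) k k)) =
    cls 0 0 (rtr k (reta K)).
  by rewrite /closed_trace /= /geta hcast_cls; apply: gtrnE.
have plugE k (K : 'M[nat]_k) :
    flow_equiv K (mx_of (@plug 0 0 (rtr k (reta K)) (rid 0))).
  apply: flow_trans (fe_mx K) _.
  apply: (fe_iso (h := inl)).
    exists (fun x : 'I_k + 'I_0 => match x with
      inr u => match notF (ltn_ord u) with end | inl v => v end) => //.
    by case=> [|[]].
  by move=> i j /=; rewrite add0n (sum_ord_deltal i) nmxE.
rewrite !closedE => /cls_inj/(_ (rid 0)) MN.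
exact: flow_trans (plugE _ M) (flow_trans MN (flow_sym (plugE _ N))).
Qed.

(** * Closed traces are invariant under flow equivalence *)

Section TracedInvariance.
Variable Q : traced_prop.

Lemma hcast_id (H : nat -> nat -> Type) n m (en : n = n) (em : m = m) (f : H n m) :
  hcast en em f = f.
Proof. by rewrite (eq_irrelevance en erefl) (eq_irrelevance em erefl). Qed.

Lemma hcast_comp n m p n' m' p' (en : n = n') (em : m = m') (ep : p = p')
    (g : phom Q m p) (f : phom Q n m) :
  hcast en ep (pcomp g f) = pcomp (hcast em ep g) (hcast en em f).
Proof. by case: n' / en; case: m' / em; case: p' / ep. Qed.

Lemma hcastK (H : nat -> nat -> Type) n m n' m' (en : n = n') (em : m = m')
    (f : H n m) :
  hcast (esym en) (esym em) (hcast en em f) = f.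
Proof. by case: n' / en; case: m' / em. Qed.

(** This is sliding with [p = q = 0], up to the casts along [addn0]. *)
Lemma closed_traceC n m (f : phom Q m n) (g : phom Q n m) :
  closed_trace (pcomp f g) = closed_trace (pcomp g f).
Proof.
rewrite /closed_trace /trn.
rewrite (hcast_comp _ (esym (addn0 m))) [in RHS](hcast_comp _ (esym (addn0 n))).
have -> : hcast (esym (addn0 n)) (esym (addn0 m)) g = tens g (pidm 0).
  by rewrite -{1}(tensm1 g) hcastK.
exact: tr_sliding.
Qed.

Lemma tr_hcast n m n' m' (en : n = n') (em : m = m')
    (e1n : 1 + n = 1 + n') (e1m : 1 + m = 1 + m') (f : phom Q (1 + n) (1 + m)) :
  tr (hcast e1n e1m f) = hcast en em (tr f).
Proof.
case: n' / en e1n => e1n; case: m' / em e1m => e1m.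
by rewrite !hcast_id.
Qed.

Lemma closed_trace_tr n (f : phom Q (1 + n) (1 + n)) :
  closed_trace f = closed_trace (tr f).
Proof.
rewrite /closed_trace /trn /=; congr iter_tr; exact: tr_hcast.
Qed.

Lemma sw1S n :
  @sw Q 1 (1 + n) =
  @pcomp Q (1 + (1 + n)) (1 + (1 + n)) (1 + (n + 1))
    (tens (pidm 1) (sw 1 n)) (tens (sw 1 1) (pidm n)).
Proof.
rewrite swD; etransitivity; first exact: hcast_id.
congr pcomp; exact: hcast_id.
Qed.

(** The delayed morphism is [F] conjugated by a symmetry, where [F] first applies [f] beside a fresh
    wire and then crosses that wire with the first output of [f]. Cyclicity removes the
    conjugation. *)
Lemma closed_trace_delay n (f : phom Q (1 + n) (1 + n)) :
  closed_trace (pcomp (tens (pidm 1) (pcomp (sw 1 n) f)) (sw (1 + n) 1)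
                : phom Q (1 + n + 1) (1 + n + 1)) =
  closed_trace f.
Proof.
pose F : phom Q (1 + (1 + n)) (1 + (1 + n)) :=
  pcomp (tens (sw 1 1) (pidm n)) (tens (pidm 1) f).
have -> : tens (pidm 1) (pcomp (sw 1 n) f) = pcomp (sw 1 (1 + n)) F.
  have FE : pcomp (tens (sw 1 1) (pidm n)) F = tens (pidm 1) f.
    rewrite /F (compA (m := 1 + 1 + n) (p := 1 + 1 + n)).
    by rewrite -tens_comp swK comp1m tens11 comp1m.
  rewrite sw1S -(compA (m := 1 + 1 + n)) FE.
  by rewrite -{1}(comp1m (pidm 1)); apply: tens_comp.
rewrite closed_traceC compA swK comp1m closed_trace_tr.
(* Tightening pulls [f] out of the trace over the fresh wire; what is left is the trace of the
   crossing tensored with an identity, which strength and yanking make trivial. *)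
rewrite -[F]comp1m -tens11 /F compA tr_tightening comp1m.
have -> : @tr Q (1 + n) (1 + n) (tens (sw 1 1) (pidm n)) = pidm (1 + n).
  etransitivity; first exact: (tr_strength (m := 1) (n := 1)).
  by rewrite tr_yanking; apply: tens11.
by rewrite comp1m.
Qed.

Lemma flow_closed_trace (iota : prop_functor (mat_prop nat) Q) m n
    (M : 'M[nat]_m) (N : 'M[nat]_n) : flow_equiv M N ->
  closed_trace (fmap iota (M : phom (mat_prop nat) m m)) =
  closed_trace (fmap iota (N : phom (mat_prop nat) n n)).
Proof.
elim=> {m n M N} //.
- by move=> n m p M N L _ -> _ ->.
- move=> n m R S.
  have := fmap_comp iota (R : phom (mat_prop nat) m n) (S : phom (mat_prop nat) n m).
  have := fmap_comp iota (S : phom (mat_prop nat) n m) (R : phom (mat_prop nat) m n).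
  by rewrite /= /mat_comp => -> ->; apply: closed_traceC.
move=> n a A; rewrite -closed_trace_delay.
pose M : phom (mat_prop nat) (1 + n) (1 + n) := col_mx a A.
have swM : (mat_sw nat 1 n *m col_mx a A = col_mx A a)%R.
  by rewrite mul_block_col !mul0mx !mul1mx add0r addr0.
(* The expanded matrix is put in the form of [closed_trace_delay]: [sw 1 n] moves the row [a] below
   [A], and [sw (1 + n) 1] puts the last column in front. *)
have -> : (block_mx 0 (1%:M : 'M[nat]_1) (col_mx A a) 0)%R =
    @pcomp (mat_prop nat) (1 + n + 1) (1 + (1 + n)) (1 + (n + 1))
      (tens (pidm 1) (pcomp (sw 1 n) M)) (sw (1 + n) 1).
  rewrite /= /mat_comp /mat_tens /mat_sw [in RHS]mulmx_block.
  rewrite !mulmx0 !mul0mx !mulmx1 !add0r !addr0.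
  by rewrite -swM.
by rewrite !(fmap_comp, fmap_tens, fmap1, fmap_sw) (fmap_sw iota (1 + n) 1).
Qed.
End TracedInvariance.

(** * Transfer from the completion to open graphs *)

Lemma fmap_hcast (P Q : prop_cat) (F : prop_functor P Q) n m n' m'
    (en : n = n') (em : m = m') (f : phom P n m) :
  fmap F (hcast en em f) = hcast en em (fmap F f).
Proof. by case: n' / en; case: m' / em. Qed.

Lemma fmap_closed_trace (P Q : traced_prop) (F : prop_functor P Q) n
    (f : phom P n n) : is_traced_functor F ->
  fmap F (closed_trace f) = closed_trace (fmap F f).
Proof.
move=> FT; rewrite /closed_trace -fmap_hcast /trn; move: (hcast _ _ f) => {}f.
elim: n f => //= n IH f; rewrite IH; congr iter_tr; exact/esym/FT.
Qed.

Theorem theorem1 (Mhat : traced_prop) (iota : prop_functor (mat_prop nat) Mhat)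
    (iotaP : is_traced_completion iota)
    (m n : nat) (M : 'M[nat]_m) (N : 'M[nat]_n) :
  closed_trace (fmap iota (M : phom (mat_prop nat) m m)) =
  closed_trace (fmap iota (N : phom (mat_prop nat) n n)) <->
  flow_equiv M N.
Proof.
split=> [MN|]; last exact: flow_closed_trace.
(* The traced functor induced by the completion carries the equality of closed traces to the prop of
   open graphs, where closed traces separate flow classes. *)
have [G [GT Giota _]] := iotaP graph_traced graph_functor.
apply: closed_trace_flow.
by rewrite -!Giota -!fmap_closed_trace // MN.
Qed.
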